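(* Let $A\in\mathbb{R}^{n\times n}$ be passive, $B\in\mathbb{R}^{n\times q}$, $C\in\mathbb{R}^{p\times n}$, $x_0\in\mathbb{C}^n$, and let $V_k\in\mathbb{R}^{n\times d_k}$ have orthonormal columns. Put $T_k=V_k^*AV_k$, $B_k=V_k^*B$, $C_k=CV_k$, $\widehat x_0=V_k^*x_0$; let $Y_k\ge0$ be the stabilizing solution of $T_k^*Y+YT_k-YB_kB_k^*Y+C_k^*C_k=0$, let $X_k=V_kY_kV_k^*$ and $R_k=A^*X_k+X_kA-X_kBB^*X_k+C^*C$. Assume that $A-BB^*X_k$ is stable, and set $x_k(t)=\exp((A-BB^*X_k)t)x_0$ and $u_k(t)=-B^*X_kx_k(t)$ for $t\ge0$. Let $\widehat u_*(t)=-B_k^*Y_k\exp((T_k-B_kB_k^*Y_k)t)\widehat x_0$ be the optimal control of the reduced system. If $\alpha>0$ is such that $\|e^{(A-BB^*X_k)^*t}\|\le e^{-\alpha t}$ for all $t\ge0$, then $$|\mathcal{J}(u_k,x_0)-\widehat{\mathcal{J}}_k(\widehat u_*,\widehat x_0)|\le\frac{\|R_k\|}{2\alpha}\,x_0^*x_0 .$$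
   Context: $M^*$ denotes the conjugate transpose and $\|\cdot\|$ the Euclidean vector norm and induced matrix norm. $Y\ge0$ means symmetric positive semidefinite. A matrix is stable if all its eigenvalues lie in the open left half complex plane; $A$ is passive if its field of values $\{x^*Ax/(x^*x): 0\ne x\in\mathbb{C}^n\}$ lies in the open left half plane. If $A$ is passive then $T_k$ is stable and the reduced Riccati equation has a unique positive semidefinite solution $Y_k$ that is stabilizing, i.e. such that $T_k-B_kB_k^*Y_k$ is stable. The cost functionals are $\mathcal{J}(u,x_0)=\int_0^\infty (x(t)^*C^*Cx(t)+u(t)^*u(t))\,dt$, where $\dot x=Ax+Bu$, $x(0)=x_0$, and $\widehat{\mathcal{J}}_k(\widehat u,\widehat x_0)=\int_0^\infty(\widehat x(t)^*C_k^*C_k\widehat x(t)+\widehat u(t)^*\widehat u(t))\,dt$, where $\dot{\widehat x}=T_k\widehat x+B_k\widehat u$, $\widehat x(0)=\widehat x_0$. *)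

(* Defs.v *)
From HB Require Import structures.
From mathcomp Require Import all_boot all_order all_algebra.
From mathcomp Require Import spectral sesquilinear complex.
From mathcomp Require Import all_classical all_reals all_analysis.

Set Implicit Arguments.
Unset Strict Implicit.
Unset Printing Implicit Defensive.

Import Order.TTheory GRing.Theory Num.Theory.
Import numFieldNormedType.Exports.

Local Open Scope classical_set_scope.
Local Open Scope ring_scope.
Local Open Scope complex_scope.
Local Open Scope sesquilinear_scope.

(* The data matrices are real, while vectors (initial values, states, controls,
   test vectors) are complex. For a real matrix M, the conjugate transpose M^*
   is M^T; for complex vectors it is x ^t*. *)
Definition toC (R : realType) (m n : nat) (M : 'M[R]_(m, n)) : 'M[R[i]]_(m, n) :=
  map_mx (real_complex R) M.

Definition vecnorm (R : realType) (n : nat) (x : 'cV[R[i]]_n) : R :=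
  Num.sqrt (\sum_(i < n) Normc.normc (x i 0) ^+ 2).

Definition opnorm (R : realType) (m n : nat) (M : 'M[R[i]]_(m, n)) : R :=
  sup [set vecnorm (M *m x) | x in [set x : 'cV[R[i]]_n | vecnorm x <= 1]].

Definition stable (R : realType) (n : nat) (M : 'M[R]_n) : Prop :=
  forall z : R[i], eigenvalue (toC M) z -> complex.Re z < 0.

Definition field_of_values (R : realType) (n : nat) (M : 'M[R]_n) : set R[i] :=
  [set (x ^t* *m toC M *m x) 0 0 / (x ^t* *m x) 0 0
     | x in [set x : 'cV[R[i]]_n | x != 0]].

Definition passive (R : realType) (n : nat) (M : 'M[R]_n) : Prop :=
  forall z, field_of_values M z -> complex.Re z < 0.

Definition psd (R : realType) (n : nat) (Y : 'M[R]_n) : Prop :=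
  Y^T = Y /\ forall x : 'cV[R]_n, 0 <= (x^T *m Y *m x) 0 0.

Definition riccati (R : realType) (n q p : nat) (A : 'M[R]_n) (B : 'M[R]_(n, q))
    (C : 'M[R]_(p, n)) (X : 'M[R]_n) : 'M[R]_n :=
  A^T *m X + X *m A - X *m B *m B^T *m X + C^T *m C.

(* The limit is taken in the normed module 'M[R]_n. *)
Definition expmx (R : realType) (n : nat) (M : 'M[R]_n) : 'M[R]_n :=
  limn (series (fun k : nat => (k`!%:R)^-1 *: M ^+ k)).

(* x' = A x + B u, x(0) = x0, on [0, +oo[: x is continuous on [0, +oo[ and
   differentiable on ]0, +oo[. The topology and the derivative are those of the
   real and imaginary parts, as R[i] is not a normed module over R in the
   library. *)
Definition is_trajectory (R : realType) (n q : nat) (A : 'M[R]_n)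
    (B : 'M[R]_(n, q)) (u : R -> 'cV[R[i]]_q) (x0 : 'cV[R[i]]_n)
    (x : R -> 'cV[R[i]]_n) : Prop :=
  let rhs t := toC A *m x t + toC B *m u t in
  [/\ x 0 = x0,
      {within `[0, +oo[, continuous (fun t => map_mx (@complex.Re R) (x t))},
      {within `[0, +oo[, continuous (fun t => map_mx (@complex.Im R) (x t))} &
      forall t : R, 0 < t ->
        is_derive t 1 (fun s => map_mx (@complex.Re R) (x s))
                      (map_mx (@complex.Re R) (rhs t)) /\
        is_derive t 1 (fun s => map_mx (@complex.Im R) (x s))
                      (map_mx (@complex.Im R) (rhs t))].

(* A trajectory, which is unique on [0, +oo[ when there is one; the constant
   default is irrelevant as soon as a trajectory exists. *)
Definition trajectory (R : realType) (n q : nat) (A : 'M[R]_n)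
    (B : 'M[R]_(n, q)) (u : R -> 'cV[R[i]]_q) (x0 : 'cV[R[i]]_n) :
    R -> 'cV[R[i]]_n :=
  xget (fun=> x0) [set x | is_trajectory A B u x0 x].

(* The integrand is a nonnegative real, seen in R[i]; hence the real part.
   The value is +oo when the integral diverges. *)
Definition cost (R : realType) (n q p : nat) (A : 'M[R]_n) (B : 'M[R]_(n, q))
    (C : 'M[R]_(p, n)) (u : R -> 'cV[R[i]]_q) (x0 : 'cV[R[i]]_n) : \bar R :=
  let x := trajectory A B u x0 in
  (\int[@lebesgue_measure R]_(t in `[0%R, +oo[)
    (complex.Re (((x t) ^t* *m toC (C^T *m C) *m x t + (u t) ^t* *m u t) 0 0))%:E)%E.

(* Main.v *)
Require Import Defs.
From mathcomp Require Import all_boot all_order all_algebra.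
From mathcomp Require Import spectral sesquilinear complex.
From mathcomp Require Import all_classical all_reals all_analysis.
From mathcomp Require Import measurable_realfun ring lra.
Import Order.TTheory GRing.Theory Num.Theory.
Import numFieldNormedType.Exports.
Local Open Scope ring_scope.
Local Open Scope complex_scope.
Local Open Scope sesquilinear_scope.

(* Write L = A - B B^T X and x(t) = exp(t L) x0. Since
   L^T X + X L + C^T C + X B B^T X = R(X), the cost integrand along the feedback
   u = - B^T X x is x^* R(X) x - d/dt (x^* X x), so once x^* X x tends to 0 the
   cost differs from x0^* X x0 by the integral of x^* R(X) x, which is at most
   |R(X)| |x0|^2 times the integral of exp(- 2 alpha t). For the reduced system
   the residual vanishes and the cost is exactly
   (V^T x0)^* Y (V^T x0) = x0^* X x0.
   The decay of the reduced optimal trajectory comes from a Lyapunov function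
   |x|^2 + k x^* Y x, using that T inherits passivity from A; this bypasses the
   spectral stability of T - Bk Bk^T Y. As the matrices are real, everything
   splits into real and imaginary parts. *)

Set Implicit Arguments.
Unset Strict Implicit.
Unset Printing Implicit Defensive.

Local Open Scope classical_set_scope.

(** * Quadratic forms of real matrices *)

Definition quadf (R : realType) (n : nat) (M : 'M[R]_n) (x : 'cV[R]_n) : R :=
  (x^T *m M *m x) 0 0.

Section quadratic_forms.
Variable R : realType.
Implicit Types (n m : nat).

Lemma quadfE n (M : 'M[R]_n) x :
  quadf M x = \sum_i \sum_j x i 0 * M i j * x j 0.
Proof.
rewrite /quadf mxE exchange_big /=; apply: eq_bigr => j _.
by rewrite mxE mulr_suml; apply: eq_bigr => i _; rewrite !mxE.
Qed.

(** [quadf 1%:M] serves throughout as the squared Euclidean norm, so that norms and Lyapunov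
    functions share one calculus. *)
Lemma quadf1E n (x : 'cV[R]_n) : quadf 1%:M x = \sum_i x i 0 ^+ 2.
Proof. by rewrite /quadf mulmx1 mxE; apply: eq_bigr => i _; rewrite mxE. Qed.

Lemma quadf1_ge0 n (x : 'cV[R]_n) : 0 <= quadf 1%:M x.
Proof. by rewrite quadf1E sumr_ge0 // => i _; rewrite sqr_ge0. Qed.

Lemma quadf1_eq0 n (x : 'cV[R]_n) : quadf 1%:M x = 0 -> x = 0.
Proof.
rewrite quadf1E => /eqP; rewrite psumr_eq0 => [/allP h|i _]; last exact: sqr_ge0.
apply/matrixP => i j; rewrite mxE ord1; apply/eqP.
by rewrite -sqrf_eq0; apply: h; rewrite mem_index_enum.
Qed.

Lemma quadf1_gt0 n (x : 'cV[R]_n) : x != 0 -> 0 < quadf 1%:M x.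
Proof.
move=> x0; rewrite lt_def quadf1_ge0 andbT.
by apply: contra x0 => /eqP/quadf1_eq0 ->.
Qed.

Lemma quadfD n (M N : 'M[R]_n) x : quadf (M + N) x = quadf M x + quadf N x.
Proof. by rewrite /quadf mulmxDr mulmxDl mxE. Qed.

Lemma quadfZ n c (M : 'M[R]_n) x : quadf (c *: M) x = c * quadf M x.
Proof. by rewrite /quadf -scalemxAr -scalemxAl mxE. Qed.

Lemma quadfN n (M : 'M[R]_n) x : quadf (- M) x = - quadf M x.
Proof. by rewrite -scaleN1r quadfZ mulN1r. Qed.

Lemma quadf0 n (x : 'cV[R]_n) : quadf 0 x = 0.
Proof. by rewrite /quadf mulmx0 mul0mx mxE. Qed.

Lemma quadf_tr n (M : 'M[R]_n) x : quadf M^T x = quadf M x.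
Proof.
rewrite /quadf.
have -> : x^T *m M^T *m x = (x^T *m M *m x)^T by rewrite !trmx_mul trmxK mulmxA.
by rewrite mxE.
Qed.

Lemma quadf_mul n m (M : 'M[R]_n) (N : 'M[R]_(n, m)) x :
  quadf M (N *m x) = quadf (N^T *m M *m N) x.
Proof. by rewrite /quadf trmx_mul !mulmxA. Qed.

Lemma quadf1_mul n m (N : 'M[R]_(n, m)) x :
  quadf 1%:M (N *m x) = quadf (N^T *m N) x.
Proof. by rewrite quadf_mul mulmx1. Qed.

Lemma quadfZv n c (M : 'M[R]_n) x : quadf M (c *: x) = c ^+ 2 * quadf M x.
Proof.
rewrite !quadfE mulr_sumr; apply: eq_bigr => i _.
by rewrite mulr_sumr; apply: eq_bigr => j _; rewrite !mxE; ring.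
Qed.

Lemma quadfv0 n (M : 'M[R]_n) : quadf M 0 = 0.
Proof. by rewrite /quadf mulmx0 mxE. Qed.

Lemma quadfNv n (M : 'M[R]_n) x : quadf M (- x) = quadf M x.
Proof. by rewrite -scaleN1r quadfZv sqrrN expr1n mul1r. Qed.

Lemma quadf1_lincomb n a b (x y : 'cV[R]_n) :
  quadf 1%:M (a *: x - b *: y) =
  a ^+ 2 * quadf 1%:M x - 2 * a * b * (x^T *m y) 0 0 + b ^+ 2 * quadf 1%:M y.
Proof.
rewrite !quadf1E mxE !mulr_sumr -sumrB -big_split /=.
by apply: eq_bigr => i _; rewrite !mxE; ring.
Qed.

(** Expand [|e x - y|^2 >= 0] and divide by [e]. *)
Lemma young n e (x y : 'cV[R]_n) : 0 < e ->
  2 * (x^T *m y) 0 0 <= e * quadf 1%:M x + e^-1 * quadf 1%:M y.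
Proof.
move=> e0; rewrite -(ler_pM2l e0) mulrDr [_ * (e^-1 * _)]mulrA.
rewrite (divff (lt0r_neq0 e0)) mul1r.
have := quadf1_ge0 (e *: x - 1 *: y); rewrite quadf1_lincomb; nra.
Qed.

(** With [b = |y|^2] and [c = x^T y], the square [|b x - c y|^2] equals [b (|x|^2 b - c^2)], and
    [b > 0] cancels; [y = 0] is treated apart. *)
Lemma cauchy_schwarz n (x y : 'cV[R]_n) :
  `|(x^T *m y) 0 0| <=
  Num.sqrt (quadf 1%:M x) * Num.sqrt (quadf 1%:M y).
Proof.
rewrite -sqrtrM ?quadf1_ge0 // -sqrtr_sqr ler_wsqrtr //.
have [y0|] := eqVneq (quadf 1%:M y) 0.
  by rewrite (quadf1_eq0 y0) mulmx0 mxE expr0n /= mulr_ge0 ?quadf1_ge0.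
rewrite neq_lt ltNge quadf1_ge0 /= => y0.
have := quadf1_ge0 (quadf 1%:M y *: x - (x^T *m y) 0 0 *: y).
rewrite quadf1_lincomb; set a := quadf _ x; set b := quadf _ y in y0 *.
set c := (_ *m _) 0 0 => h.
rewrite -subr_ge0 -(pmulr_rge0 _ y0).
by apply: le_trans h _; rewrite le_eqVlt; apply/orP; left; apply/eqP; ring.
Qed.

Lemma quadf_bound n (M : 'M[R]_n) :
  exists2 c, 0 < c & forall x, `|quadf M x| <= c * quadf 1%:M x.
Proof.
(* The summand 1 keeps the constant positive even when [M = 0]. *)
exists (1 + \sum_i \sum_j `|M i j|) => [|x].
  by apply: ltr_pwDl => //; do 2! apply: sumr_ge0 => ? _.
have xle i : `|x i 0| <= Num.sqrt (quadf 1%:M x).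
  rewrite -sqrtr_sqr ler_wsqrtr // quadf1E (bigD1 i) //= lerDl.
  by rewrite sumr_ge0 // => j _; rewrite sqr_ge0.
rewrite mulrDl mul1r -[leLHS]add0r lerD ?quadf1_ge0 // quadfE mulr_suml.
rewrite (le_trans (ler_norm_sum _ _ _)) //; apply: ler_sum => i _.
rewrite mulr_suml (le_trans (ler_norm_sum _ _ _)) //; apply: ler_sum => j _.
rewrite !normrM mulrAC mulrC ler_wpM2l //.
by rewrite -[leRHS]sqr_sqrtr ?quadf1_ge0 // expr2 ler_pM.
Qed.

Lemma continuous_quadf (T : topologicalType) n (M : 'M[R]_n) (x : T -> 'cV[R]_n) :
  (forall i, continuous (fun t => x t i 0)) -> continuous (fun t => quadf M (x t)).
Proof.
move=> cx t; under eq_fun do rewrite quadfE.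
apply: cvg_big => [|i _]; first exact: add_continuous.
apply: cvg_big => [|j _]; first exact: add_continuous.
by apply: cvgM; [apply: cvgM => //; [exact: cx|exact: cvg_cst]|exact: cx].
Qed.

(** By compactness the form attains a negative maximum on the unit sphere, and homogeneity of degree
    2 carries the bound to all vectors. *)
Lemma neg_quadf_coercive n (M : 'M[R]_n) :
  (forall x, x != 0 -> quadf M x < 0) ->
  exists2 b, 0 < b & forall x, quadf M x <= - b * quadf 1%:M x.
Proof.
move=> Mneg.
(* The unit sphere, in row vectors to match the extreme value theorem [EVT_max_rV]. *)
pose S := [set r : 'rV[R]_n | quadf 1%:M r^T = 1].
have cq N : continuous (fun r : 'rV[R]_n => quadf N r^T).
  apply: continuous_quadf => i; under eq_fun do rewrite mxE.
  exact: coord_continuous.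
have scale x : x != 0 :> 'cV[R]_n ->
    S (((Num.sqrt (quadf 1%:M x))^-1 *: x)^T) /\ 0 < quadf 1%:M x.
  move=> /quadf1_gt0 q0.
  split=> //; rewrite /S /= trmxK quadfZv exprVn sqr_sqrtr ?(ltW q0) //.
  by rewrite mulVf // gt_eqF.
(* If the sphere is empty (dimension 0), the only vector is 0 and [b = 1] will do. *)
have [[r0 r0S]|S0] := pselect (S !=set0); last first.
  exists 1 => // x; have [->|/scale[xS _]] := eqVneq x 0.
    by rewrite !quadfv0 mulr0.
  by exfalso; apply: S0; eexists; exact: xS.
have Sb : bounded_set S.
  exists 1; split => [|c c1 r rS]; first exact: num_real.
  rewrite /= [leLHS]/Num.Def.normr /= mx_normrE.
  apply: (bigmax_le _ (ltW (lt_trans ltr01 c1))) => -[i j] _ /=.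
  rewrite ord1; apply: le_trans (ltW c1).
  rewrite -sqrtr_sqr -(sqrtr1 R) ler_wsqrtr // -rS quadf1E.
  by rewrite (bigD1 j) //= mxE lerDl sumr_ge0 // => k _; rewrite sqr_ge0.
have Sc : closed S.
  apply: (@closed_comp _ _ (fun r : 'rV[R]_n => quadf 1%:M r^T) [set 1]) => //.
have cM : {within S, continuous (fun r : 'rV[R]_n => quadf M r^T)}.
  by apply: continuous_subspaceT; exact: cq.
have [c cS cmax] := EVT_max_rV (ex_intro _ r0 r0S)
  (bounded_closed_compact Sb Sc) cM.
exists (- quadf M c^T) => [|x].
  rewrite oppr_gt0; apply: Mneg; apply: contraPneq cS => c0.
  rewrite inE /S /= c0 quadfv0.
  by apply/eqP; rewrite eq_sym oner_eq0.
have [->|/scale[xS q0]] := eqVneq x 0.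
  by rewrite !quadfv0 mulr0.
have := cmax _ (mem_set xS); rewrite trmxK quadfZv exprVn sqr_sqrtr ?(ltW q0) //.
by rewrite opprK -ler_pdivrMr // mulrC.
Qed.

End quadratic_forms.

(** * Entrywise calculus of matrix-valued functions *)

Section matrix_derivative.
Variable R : realType.
Implicit Types (m n p : nat) (t : R).

(** There are finitely many entries, so nearness of each one holds for all of them
    simultaneously. *)
Lemma cvg_mx (T : Type) (F : set_system T) {FF : Filter F} m n
    (f : T -> 'M[R]_(m, n)) (l : 'M[R]_(m, n)) :
  (forall i j, f t i j @[t --> F] --> l i j) -> f @ F --> l.
Proof.
move=> fl A [P lP PA].
have FP : \forall t \near F, forall i j, P i j (f t i j).
  apply: filter_forall => i; apply: filter_forall => j.
  by apply: fl; exact: lP.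
by apply: filterS FP => t Pt; exact: PA Pt.
Qed.

Lemma is_derive_mxP m n (F : R -> 'M[R]_(m, n)) (D : 'M[R]_(m, n)) t :
  is_derive t 1 F D <-> forall i j, is_derive t 1 (fun s => F s i j) (D i j).
Proof.
split=> [[dF <-] i j|h].
  rewrite derive_mx // mxE; apply: DeriveDef => //.
  exact: (derivable_mxP _ _ _).1.
have dF : derivable F t 1 by apply/derivable_mxP => i j; case: (h i j).
apply: DeriveDef => //; rewrite derive_mx //; apply/matrixP => i j.
by rewrite mxE; case: (h i j).
Qed.

Lemma is_derive_mulmx m n p (F : R -> 'M[R]_(m, n)) (G : R -> 'M[R]_(n, p))
    (DF : 'M[R]_(m, n)) (DG : 'M[R]_(n, p)) t :
  is_derive t 1 F DF -> is_derive t 1 G DG ->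
  is_derive t 1 (fun s => F s *m G s) (DF *m G t + F t *m DG).
Proof.
move=> /is_derive_mxP dF /is_derive_mxP dG; apply/is_derive_mxP => i j.
have -> : (fun s => (F s *m G s) i j) =
    \sum_k ((fun s => F s i k) * (fun s => G s k j)).
  by apply/funext => s; rewrite mxE fct_sumE.
rewrite !mxE -big_split /=; apply: is_derive_sum => k.
apply: (@is_derive_eq _ _ _ _ _ _ _ _ (is_deriveM (dF i k) (dG k j))).
by rewrite /GRing.scale /= addrC [G t k j * _]mulrC.
Qed.

Lemma is_derive_trmx m n (F : R -> 'M[R]_(m, n)) (D : 'M[R]_(m, n)) t :
  is_derive t 1 F D -> is_derive t 1 (fun s => (F s)^T) D^T.
Proof.
move=> /is_derive_mxP dF; apply/is_derive_mxP => i j.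
by rewrite mxE; under eq_fun do rewrite mxE.
Qed.

Lemma is_derive_quadf n (M L : 'M[R]_n) (x : R -> 'cV[R]_n) t :
  is_derive t 1 x (L *m x t) ->
  is_derive t 1 (fun s => quadf M (x s)) (quadf (L^T *m M + M *m L) (x t)).
Proof.
move=> dx.
have dxM : is_derive t 1 (fun s => (x s)^T *m M) ((L *m x t)^T *m M).
  apply: (@is_derive_eq _ _ _ _ _ _ _ _
    (is_derive_mulmx (is_derive_trmx dx) (is_derive_cst M t 1))).
  by rewrite mulmx0 addr0.
have /is_derive_mxP/(_ 0 0) := is_derive_mulmx dxM dx.
by rewrite /quadf mulmxDr mulmxDl trmx_mul !mulmxA.
Qed.

End matrix_derivative.

(** * The matrix exponential *)

Section matrix_exponential.
Variable R : realType.
Implicit Types (m n p : nat) (t : R).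

Lemma mx_powS n (M : 'M[R]_n) k : M ^+ k.+1 = M *m M ^+ k.
Proof. by rewrite exprS. Qed.

Lemma mx_powZ n t (M : 'M[R]_n) k : (t *: M) ^+ k = t ^+ k *: M ^+ k.
Proof.
elim: k => [|k IH]; first by rewrite !expr0 scale1r.
by rewrite !mx_powS IH -scalemxAl -scalemxAr scalerA exprS.
Qed.

Lemma mx_pow_tr n (M : 'M[R]_n) k : (M^T) ^+ k = (M ^+ k)^T.
Proof.
elim: k => [|k IH]; first by rewrite !expr0 trmx1.
by rewrite mx_powS IH -trmx_mul exprSr.
Qed.

(** Induction on [k]: with [K] the sum of the absolute values of all entries, every row of [M] has
    absolute sum at most [K]. *)
Lemma mx_pow_bound n (M : 'M[R]_n) :
  exists2 K, 0 <= K & forall k i j, `|(M ^+ k) i j| <= K ^+ k.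
Proof.
exists (\sum_i \sum_j `|M i j|) => [|k].
  by do 2! apply: sumr_ge0 => ? _.
elim: k => [|k IH] i j.
  by rewrite !expr0 mxE; case: eqP => _; rewrite ?normr1 ?normr0.
rewrite mx_powS mxE (le_trans (ler_norm_sum _ _ _)) // exprS.
rewrite (@le_trans _ _ (\sum_l `|M i l| * (\sum_i \sum_j `|M i j|) ^+ k)) //.
  by apply: ler_sum => l _; rewrite normrM ler_wpM2l.
rewrite -mulr_suml ler_wpM2r //.
  by apply: exprn_ge0; do 2! apply: sumr_ge0 => ? _.
rewrite [leRHS](bigD1 i) //= lerDl.
by do 2! apply: sumr_ge0 => ? _.
Qed.

(** Coefficients of the power series in [t] of an entry of [N exp(t M)]. The factor [N] makes the
    family closed under differentiation, which replaces [N] by [N M]. *)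
Definition exp_entry n (N M : 'M[R]_n) i j : R^nat :=
  fun k => (k`!%:R)^-1 * (N *m M ^+ k) i j.

(** Domination by the scalar exponential series at [K * |t|], scaled by the absolute sum [D] of row
    [i] of [N]. *)
Lemma is_cvg_exp_entry n (N M : 'M[R]_n) i j t :
  cvgn (pseries (exp_entry N M i j) t).
Proof.
have [K K0 MK] := mx_pow_bound M.
pose D := \sum_l `|N i l|.
apply: normed_cvg.
apply: (@series_le_cvg _ _ (fun k => D * exp_coeff (K * `|t|) k)) => [k|k|k|].
- exact: normr_ge0.
- rewrite mulr_ge0 ?sumr_ge0 //.
  by rewrite /exp_coeff /= divr_ge0 // exprn_ge0 // mulr_ge0.
- rewrite /exp_entry /exp_coeff /= !normrM normrX exprMn.
  rewrite ger0_norm ?invr_ge0 // [leRHS](_ : _ = k`!%:R^-1 * (D * K ^+ k) * `|t| ^+ k).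
    rewrite ler_wpM2r ?exprn_ge0 // ler_wpM2l ?invr_ge0 //.
    rewrite mxE (le_trans (ler_norm_sum _ _ _)) // mulr_suml ler_sum // => l _.
    by rewrite normrM ler_wpM2l.
  by ring.
- apply: (@is_cvg_seriesZ _ _ D); exact: is_cvg_series_exp_coeff.
Qed.

Lemma exp_entry_diffs n (N M : 'M[R]_n) i j :
  pseries_diffs (exp_entry N M i j) = exp_entry (N *m M) M i j.
Proof.
apply/funext => k; rewrite /pseries_diffs /exp_entry mx_powS mulmxA mulrA.
by rewrite factS natrM invfM mulrA divff ?mul1r // pnatr_eq0.
Qed.

(** Reduces the matrix series to scalar power series, which can be differentiated term by term. *)
Lemma expmx_entry n (M : 'M[R]_n) t i j :
  expmx (t *: M) i j = limn (pseries (exp_entry 1%:M M i j) t).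
Proof.
pose l := \matrix_(i, j) limn (pseries (exp_entry 1%:M M i j) t).
suff : series (fun k => (k`!%:R)^-1 *: (t *: M) ^+ k) @ \oo --> l.
  by move=> /cvg_lim; rewrite /expmx => -> //; rewrite mxE.
apply: cvg_mx => a b; rewrite mxE.
rewrite (_ : (fun _ => _) = pseries (exp_entry 1%:M M a b) t).
  exact: is_cvg_exp_entry.
apply/funext => k; rewrite /pseries /series /= summxE.
apply: eq_bigr => r _; rewrite /exp_entry mx_powZ mul1mx !mxE; ring.
Qed.

Lemma lim_exp_entry n (M : 'M[R]_n) t i j :
  limn (pseries (exp_entry M M i j) t) = (M *m expmx (t *: M)) i j.
Proof.
apply: cvg_lim => //; rewrite mxE.
rewrite (_ : pseries _ _ = (fun k => \sum_l M i l * pseries (exp_entry 1%:M M l j) t k)).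
  apply: cvg_big => [|l _]; first exact: add_continuous.
  by apply: cvgMr; rewrite expmx_entry; exact: is_cvg_exp_entry.
apply/funext => k; rewrite /pseries /series /=.
under [RHS]eq_bigr do rewrite mulr_sumr.
rewrite exchange_big /=; apply: eq_bigr => r _.
rewrite /exp_entry mxE mulr_sumr mulr_suml; apply: eq_bigr => l _.
by rewrite mul1mx; ring.
Qed.

Lemma is_derive_expmx n (M : 'M[R]_n) t :
  is_derive t 1 (fun s => expmx (s *: M)) (M *m expmx (t *: M)).
Proof.
apply/is_derive_mxP => i j; rewrite -lim_exp_entry.
under eq_fun do rewrite expmx_entry.
have := exp_entry_diffs 1%:M M i j; rewrite mul1mx => <-.
(* Termwise differentiation asks for convergence at a point beyond [|t|]; these series converge
   everywhere, so [|t| + 1] serves. *)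
apply: (@pseries_snd_diffs _ _ (`|t| + 1));
  rewrite ?exp_entry_diffs; try exact: is_cvg_exp_entry.
by rewrite [ltRHS]ger0_norm ?ltrDl // addr_ge0.
Qed.

Lemma expmx0 n (M : 'M[R]_n) : expmx (0 *: M) = 1%:M.
Proof.
(* The partial sum of index 0 is empty; after a shift by one, every partial sum is the identity. *)
apply: cvg_lim => //; rewrite -cvg_shiftS /=.
rewrite (_ : (fun _ => _) = cst 1%:M); first exact: cvg_cst.
apply/funext => k; rewrite /series /= big_nat_recl // expr0 invr1 scale1r.
by rewrite big1 ?addr0 // => r _; rewrite scale0r mx_powS mul0mx scaler0.
Qed.

Lemma expmx_tr n (M : 'M[R]_n) t : expmx (t *: M^T) = (expmx (t *: M))^T.
Proof.
apply/matrixP => i j; rewrite mxE !expmx_entry; congr (limn (pseries _ t)).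
by apply/funext => k; rewrite /exp_entry mx_pow_tr !mul1mx mxE.
Qed.

End matrix_exponential.

(** * Real and imaginary parts, passivity and the operator norm *)

Section complexification.
Variable R : realType.
Implicit Types (m n p : nat).

Local Notation Re := (map_mx (@complex.Re R)).
Local Notation Im := (map_mx (@complex.Im R)).

Lemma Re_toC m n p (M : 'M[R]_(m, n)) (x : 'M[R[i]]_(n, p)) :
  Re (toC M *m x) = M *m Re x.
Proof.
apply/matrixP => i j; rewrite !mxE raddf_sum /=; apply: eq_bigr => k _.
by rewrite !mxE; case: (x k j) => a b /=; rewrite mul0r subr0.
Qed.

Lemma Im_toC m n p (M : 'M[R]_(m, n)) (x : 'M[R[i]]_(n, p)) :
  Im (toC M *m x) = M *m Im x.
Proof.
apply/matrixP => i j; rewrite !mxE raddf_sum /=; apply: eq_bigr => k _.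
by rewrite !mxE; case: (x k j) => a b /=; rewrite mul0r addr0.
Qed.

Lemma complex_mxP m n (x y : 'M[R[i]]_(m, n)) : Re x = Re y -> Im x = Im y -> x = y.
Proof.
move=> /matrixP hR /matrixP hI; apply/matrixP => i j.
have := hR i j; have := hI i j; rewrite !mxE.
by case: (x i j) (y i j) => [a b] [c d] /= -> ->.
Qed.

Lemma ReD m n (x y : 'M[R[i]]_(m, n)) : Re (x + y) = Re x + Re y.
Proof. by apply/matrixP => i j; rewrite !mxE raddfD. Qed.

Lemma ImD m n (x y : 'M[R[i]]_(m, n)) : Im (x + y) = Im x + Im y.
Proof. by apply/matrixP => i j; rewrite !mxE raddfD. Qed.

Lemma ReN m n (x : 'M[R[i]]_(m, n)) : Re (- x) = - Re x.
Proof. by apply/matrixP => i j; rewrite !mxE raddfN. Qed.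

Lemma ImN m n (x : 'M[R[i]]_(m, n)) : Im (- x) = - Im x.
Proof. by apply/matrixP => i j; rewrite !mxE raddfN. Qed.

Lemma Re_real m n (x : 'M[R]_(m, n)) : Re (toC x) = x.
Proof. by apply/matrixP => i j; rewrite !mxE. Qed.

Lemma Im_real m n (x : 'M[R]_(m, n)) : Im (toC x) = 0.
Proof. by apply/matrixP => i j; rewrite !mxE. Qed.

Lemma Re_dotc n (x y : 'cV[R[i]]_n) :
  complex.Re ((x ^t* *m y) 0 0) =
  ((Re x)^T *m Re y) 0 0 + ((Im x)^T *m Im y) 0 0.
Proof.
rewrite !mxE raddf_sum -big_split /=; apply: eq_bigr => i _; rewrite !mxE.
by case: (x i 0) (y i 0) => [a b] [c d] /=; rewrite mulNr opprK.
Qed.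

Lemma Re_hermitian n (M : 'M[R]_n) (x : 'cV[R[i]]_n) :
  complex.Re ((x ^t* *m toC M *m x) 0 0) = quadf M (Re x) + quadf M (Im x).
Proof. by rewrite -mulmxA Re_dotc Re_toC Im_toC /quadf !mulmxA. Qed.

Lemma vecnormE n (x : 'cV[R[i]]_n) :
  vecnorm x = Num.sqrt (quadf 1%:M (Re x) + quadf 1%:M (Im x)).
Proof.
rewrite /vecnorm !quadf1E -big_split /=; congr Num.sqrt; apply: eq_bigr => i _.
rewrite !mxE; case: (x i 0) => a b /=.
by rewrite sqr_sqrtr // addr_ge0 // sqr_ge0.
Qed.

(** Seen as a complex vector, a real [x] contributes the real number [quadf A x / |x|^2] to the
    field of values. *)
Lemma passive_quadf n (A : 'M[R]_n) x : passive A -> x != 0 -> quadf A x < 0.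
Proof.
move=> pA x0.
have q0 := quadf1_gt0 x0.
have form (M : 'M[R]_n) : ((toC x) ^t* *m toC M *m toC x) 0 0 = (quadf M x)%:C.
  rewrite /quadf !mxE rmorph_sum; apply: eq_bigr => j _.
  rewrite !mxE rmorphM /= rmorph_sum; congr (_ * _); apply: eq_bigr => i _.
  by rewrite !mxE rmorphM /=; congr (_ * _); apply/eqP; rewrite eq_complex /= oppr0 !eqxx.
have /pA : field_of_values A (quadf A x / quadf 1%:M x)%:C.
  exists (toC x).
    apply: contra_neq x0 => /(congr1 (map_mx (@complex.Re R))).
    by rewrite Re_real => ->; apply/matrixP => i j; rewrite !mxE.
  rewrite form -[X in _ / (X *m _) 0 0]mulmx1.
  have -> : 1%:M = toC 1%:M :> 'M[R[i]]_n by rewrite /toC map_mx1.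
  by rewrite form fmorph_div.
by rewrite /= pmulr_llt0 // invr_gt0.
Qed.

(** The supremum is tested on the normalized vector [x / |x|]. *)
Lemma opnorm_real m n (M : 'M[R]_(m, n)) x :
  Num.sqrt (quadf 1%:M (M *m x)) <= opnorm (toC M) * Num.sqrt (quadf 1%:M x).
Proof.
have [->|x0] := eqVneq x 0.
  have -> : M *m (0 : 'cV[R]_n) = 0 by rewrite mulmx0.
  by rewrite !quadfv0 sqrtr0 mulr0.
have q0 := quadf1_gt0 x0.
have s0 : 0 < Num.sqrt (quadf 1%:M x) by rewrite sqrtr_gt0.
rewrite -ler_pdivrMr //.
have [c c0 Mc] := quadf_bound (M^T *m M).
have scalev k r (y : 'cV[R]_k) : 0 <= r ->
    vecnorm (toC (r *: y)) = r * Num.sqrt (quadf 1%:M y).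
  move=> r0; rewrite vecnormE Re_real Im_real quadfZv.
  rewrite quadfv0 addr0.
  by rewrite sqrtrM ?sqr_ge0 // sqrtr_sqr ger0_norm.
have -> : Num.sqrt (quadf 1%:M (M *m x)) / Num.sqrt (quadf 1%:M x) =
    vecnorm (toC M *m toC ((Num.sqrt (quadf 1%:M x))^-1 *: x)).
  rewrite /toC -map_mxM -/(toC _) -scalemxAr scalev ?invr_ge0 ?(ltW s0) //.
  by rewrite mulrC.
(* An element lies below [sup] only if the set is bounded above; the bound [sqrt c] comes from the
   form [M^T M]. *)
apply: ub_le_sup.
  exists (Num.sqrt c) => _ [y y1 <-]; rewrite vecnormE Re_toC Im_toC !quadf1_mul.
  rewrite ler_wsqrtr //; have := Mc (Re y); have := Mc (Im y).
  have : quadf 1%:M (Re y) + quadf 1%:M (Im y) <= 1.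
    by move: y1; rewrite /= vecnormE -[X in _ <= X -> _]sqrtr1 ler_sqrt.
  move=> y2 /(le_trans (ler_norm _)) h1 /(le_trans (ler_norm _)) h2.
  by rewrite (le_trans (lerD h2 h1)) // -mulrDr ler_piMr // ltW.
exists (toC ((Num.sqrt (quadf 1%:M x))^-1 *: x)) => //=.
by rewrite scalev ?invr_ge0 ?(ltW s0) // mulVf // gt_eqF.
Qed.

Lemma opnorm_ge0 m n (M : 'M[R]_(m, n)) : 0 <= opnorm (toC M).
Proof.
(* When no supremum exists, [sup] has the default value 0; otherwise the image of the zero vector
   lies in the set. *)
have [[_ ub]|noub] := pselect (has_sup [set vecnorm (toC M *m x)
    | x in [set x : 'cV[R[i]]_n | vecnorm x <= 1]]); last by rewrite /opnorm sup_out.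
apply: (@le_trans _ _ (vecnorm (toC M *m 0))); first exact: sqrtr_ge0.
apply: ub_le_sup => //; exists 0 => //=.
rewrite /vecnorm big1 ?sqrtr0 // => i _.
by rewrite mxE /Normc.normc /= expr0n addr0 sqrtr0 expr0n.
Qed.

Lemma quadf_opnorm n (M : 'M[R]_n) x :
  `|quadf M x| <= opnorm (toC M) * quadf 1%:M x.
Proof.
have -> : quadf M x = (x^T *m (M *m x)) 0 0 by rewrite /quadf mulmxA.
rewrite (le_trans (cauchy_schwarz _ _)) //.
rewrite -[in leRHS](sqr_sqrtr (quadf1_ge0 x)) expr2 mulrCA.
by rewrite ler_wpM2l ?sqrtr_ge0 // opnorm_real.
Qed.

(** Since [|M x|^2 = x^T M^T (M x)] is at most [|x| c |M x|], one factor [|M x|] cancels. This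
    carries the decay assumed for the transposed exponential over to the exponential itself. *)
Lemma quadf1_opnorm_tr m n (M : 'M[R]_(m, n)) c x : 0 <= c ->
  opnorm (toC M^T) <= c -> quadf 1%:M (M *m x) <= c ^+ 2 * quadf 1%:M x.
Proof.
move=> c0 Mc; rewrite -[leLHS]sqr_sqrtr ?quadf1_ge0 //.
rewrite -[in leRHS](sqr_sqrtr (quadf1_ge0 x)) -exprMn.
rewrite lerXn2r ?nnegrE ?mulr_ge0 ?sqrtr_ge0 //.
have [->|] := eqVneq (Num.sqrt (quadf 1%:M (M *m x))) 0.
  by rewrite mulr_ge0 ?sqrtr_ge0.
rewrite neq_lt ltNge sqrtr_ge0 /= => s0; rewrite -(ler_pM2r s0) -expr2.
rewrite sqr_sqrtr ?quadf1_ge0 // [leLHS](_ : _ = (x^T *m (M^T *m (M *m x))) 0 0);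
  last first.
  by rewrite quadf1_mul /quadf !mulmxA.
apply: le_trans (ler_norm _) _; apply: le_trans (cauchy_schwarz _ _) _.
rewrite [leRHS]mulrAC [leRHS]mulrC ler_wpM2l ?sqrtr_ge0 //.
apply: le_trans (opnorm_real _ _) _.
by rewrite ler_wpM2r ?sqrtr_ge0.
Qed.

End complexification.

(** * Exponential decay and improper integrals of scalar functions *)

Section scalar_lemmas.
Variable R : realType.
Local Notation mu := (@lebesgue_measure R).

Lemma cvgr_expRNM (c k : R) : 0 < k -> c * expR (- k * t) @[t --> +oo] --> (0 : R).
Proof.
move=> k0; rewrite -(mulr0 c); apply: cvgMr.
have -> : (fun t => expR (- k * t)) = (fun t => expR (- t)) \o ( *%R k).
  by apply/funext => t /=; rewrite mulNr.
apply: cvg_comp; last exact: cvgr_expR.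
by apply: gt0_cvgMry => //; exact: cvg_id.
Qed.

Lemma exp_bounded_cvg0 (f : R -> R) (c k : R) : 0 < k ->
  (forall t, 0 <= t -> `|f t| <= c * expR (- k * t)) -> f t @[t --> +oo] --> (0 : R).
Proof.
move=> k0 fle; apply/cvgr0Pnorm_le => e e0.
have /cvgr0Pnorm_le/(_ e e0) ce := cvgr_expRNM c k0.
near=> t; have t0 : 0 <= t by near: t; exact: nbhs_pinfty_ge.
apply: le_trans (fle t t0) _; apply: le_trans (ler_norm _) _.
by near: t; exact: ce.
Unshelve. all: by end_near. Qed.

Lemma is_derive_expRM (k t : R) :
  is_derive t 1 (fun s => expR (k * s)) (k * expR (k * t)).
Proof.
have -> : (fun s => expR (k * s)) = expR \o ( *%R k) by [].
have dk : is_derive t 1 ( *%R k) k.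
  by apply: (@is_derive_eq _ _ _ _ _ _ _ _ (is_deriveZ k (is_derive_id t 1)));
    rewrite /GRing.scale /= mulr1.
by rewrite mulrC; exact: is_derive1_comp.
Qed.

Lemma is_derive_continuous (f df : R -> R) :
  (forall t : R, is_derive t 1 f (df t)) -> continuous f.
Proof.
by move=> dfE t; apply/differentiable_continuous/derivable1_diffP; case: (dfE t).
Qed.

(** Gronwall's argument: [exp(k t) w(t)] has a nonpositive derivative. *)
Lemma exp_decay (w dw : R -> R) (k : R) :
  (forall t : R, is_derive t 1 w (dw t)) -> (forall t, dw t <= - k * w t) ->
  forall t, 0 <= t -> w t <= expR (- k * t) * w 0.
Proof.
move=> dwE dwle t t0.
pose f := (fun s => expR (k * s)) * w.
have dfE (s : R) : is_derive s 1 f (expR (k * s) * (dw s + k * w s)).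
  apply: (@is_derive_eq _ _ _ _ _ _ _ _ (is_deriveM (is_derive_expRM k s) (dwE s))).
  by rewrite /GRing.scale /=; ring.
have : f t <= f 0.
  have df s : s \in `]0, t[%R -> derivable f s 1 by case: (dfE s).
  have dn s : s \in `]0, t[%R -> f^`() s <= 0.
    move=> _; rewrite derive1E (@derive_val _ _ _ _ _ _ _ (dfE s)).
    by rewrite pmulr_rle0 ?expR_gt0 //; have := dwle s; lra.
  have cf : {within `[0, t], continuous f}.
    by apply: continuous_subspaceT; exact: is_derive_continuous dfE.
  by apply: (ler0_derive1_le_cc df dn cf); rewrite // in_itv /= ?lexx ?t0.
have fE s : f s = expR (k * s) * w s by [].
rewrite !fE mulr0 expR0 mul1r => h.
by rewrite mulNr expRN mulrC ler_pdivlMr ?expR_gt0 // mulrC.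
Qed.

(* The integrand f need not have an explicit antiderivative, so the nonnegative
   function g - v', with g t = c exp(- k t), is integrated instead: it satisfies
   f <= g - v' <= f + 2 g. *)
Lemma lyapunov_integral (f v dv : R -> R) (c k : R) :
  0 <= c -> 0 < k ->
  (forall t, 0 <= f t) -> continuous f ->
  (forall t : R, is_derive t 1 v (dv t)) -> continuous dv ->
  v t @[t --> +oo] --> 0 ->
  (forall t, 0 <= t -> `|f t + dv t| <= c * expR (- k * t)) ->
  (`| \int[mu]_(t in `[0%R, +oo[) (f t)%:E - (v 0)%:E | <= (c / k)%:E)%E.
Proof.
move=> c0 k0 f0 cf dvE cdv v0 fdv.
pose g t := c * expR (- k * t).
have dG (s : R) : is_derive s 1 (fun t => - (c / k) * expR (- k * t)) (g s).
  apply: (@is_derive_eq _ _ _ _ _ _ _ _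
    (is_deriveZ (- (c / k)) (is_derive_expRM (- k) s))).
  by rewrite /GRing.scale /= /g; field; rewrite gt_eqF.
have cg : continuous g.
  move=> s; apply: cvgM; first exact: cvg_cst.
  exact: (is_derive_continuous (is_derive_expRM (- k))).
have g0 t : 0 <= g t by rewrite mulr_ge0 // expR_ge0.
have Goo : - (c / k) * expR (- k * t) @[t --> +oo] --> (0 : R).
  exact: cvgr_expRNM.
have FTC (h H : R -> R) : (forall t, 0 <= t -> 0 <= h t) -> continuous h ->
    (forall s : R, is_derive s 1 H (h s)) -> H t @[t --> +oo] --> (0 : R) ->
    (\int[mu]_(t in `[0%R, +oo[) (h t)%:E = (- H 0)%:E)%E.
  move=> h0 ch dH Hoo.
  have dH' s : 0 < s -> derivable H s 1 by case: (dH s).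
  have HE : {in `]0, +oo[%R, H^`() =1 h}.
    by move=> s _; rewrite derive1E; case: (dH s).
  have H0 : H x @[x --> 0^'+] --> H 0.
    by apply: cvg_at_right_filter; exact: (is_derive_continuous dH).
  have ch' : {within `[0, +oo[, continuous h} by exact: continuous_subspaceT.
  by rewrite (ge0_continuous_FTC2y h0 ch' Hoo dH' H0 HE) -EFinB sub0r.
have gv : (\int[mu]_(t in `[0%R, +oo[) (g t - dv t)%:E = (c / k + v 0)%:E)%E.
  rewrite (FTC (fun t => g t - dv t) (fun t => - (c / k) * expR (- k * t) - v t)).
  - by rewrite mulr0 expR0 mulr1 opprB opprK addrC.
  - by move=> t /fdv; have := f0 t; rewrite -/(g t) ler_norml => ? /andP[]; lra.
  - by move=> s; apply: cvgB; [exact: cg|exact: cdv].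
  - by rewrite -(subr0 0); apply: cvgB.
have ig : (\int[mu]_(t in `[0%R, +oo[) (2 * g t)%:E = (2 * (c / k))%:E)%E.
  rewrite (FTC (fun t => 2 * g t) (fun t => 2 * (- (c / k) * expR (- k * t)))).
  - by rewrite mulr0 expR0 mulr1 mulrN opprK.
  - by move=> t _; rewrite mulr_ge0.
  - by move=> s; apply: cvgM; [exact: cvg_cst|exact: cg].
  - by rewrite -(mulr0 2); apply: cvgMr.
have mE (h : R -> R) : continuous h ->
    measurable_fun (`[0%R, +oo[ : set (measurableTypeR R)) (fun t => (h t)%:E).
  move=> ch; apply/measurable_EFinP; apply: measurable_funTS.
  exact: measurable_realfun.continuous_measurable_fun.
have up : (\int[mu]_(t in `[0%R, +oo[) (f t)%:E <= (c / k + v 0)%:E)%E.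
  rewrite -gv; apply: ge0_le_integral => //.
  - by move=> t _; rewrite lee_fin.
  - exact: mE.
  - by apply: mE => s; apply: cvgB; [exact: cg|exact: cdv].
  move=> t; rewrite /= in_itv /= andbT lee_fin => /fdv.
  by rewrite -/(g t) ler_norml => /andP[]; lra.
(* The correction [2 g] is added on the right, so that only nonnegative functions are integrated. *)
have lo : ((c / k + v 0)%:E <=
    \int[mu]_(t in `[0%R, +oo[) (f t)%:E + (2 * (c / k))%:E)%E.
  rewrite -ig -ge0_integralD //.
  - rewrite -gv; apply: ge0_le_integral => //.
    + move=> t; rewrite /= in_itv /= andbT lee_fin => /fdv.
      by have := f0 t; rewrite -/(g t) ler_norml => ? /andP[]; lra.
    + by apply: mE => s; apply: cvgB; [exact: cg|exact: cdv].
    + apply: emeasurable_funD; first exact: mE.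
      by apply: mE => s; apply: cvgM; [exact: cvg_cst|exact: cg].
    + move=> t; rewrite /= in_itv /= andbT -EFinD lee_fin => /fdv.
      by rewrite -/(g t) ler_norml => /andP[]; lra.
  - by move=> t _; rewrite lee_fin.
  - exact: mE.
  - by move=> t _; rewrite lee_fin mulr_ge0.
  - by apply: mE => s; apply: cvgM; [exact: cvg_cst|exact: cg].
(* The upper bound excludes [+oo] and nonnegativity excludes [-oo]; what remains is real
   arithmetic. *)
have : (0 <= \int[mu]_(t in `[0%R, +oo[) (f t)%:E)%E.
  by apply: integral_ge0 => t _; rewrite lee_fin.
move: up lo; case: (\int[mu]_(t in _) _)%E => [r| |] //=.
rewrite -EFinD !lee_fin ler_norml; lra.
Qed.

End scalar_lemmas.

(** * Trajectories and cost under linear feedback *)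

Section linear_feedback.
Variable R : realType.
Implicit Types (m n p q : nat).
Local Notation mu := (@lebesgue_measure R).
Local Notation Re := (map_mx (@complex.Re R)).
Local Notation Im := (map_mx (@complex.Im R)).

Lemma is_derive_expmx_mul n (L : 'M[R]_n) (a : 'cV[R]_n) (t : R) :
  is_derive t 1 (fun s => expmx (s *: L) *m a) (L *m (expmx (t *: L) *m a)).
Proof.
apply: (@is_derive_eq _ _ _ _ _ _ _ _
  (is_derive_mulmx (is_derive_expmx L t) (is_derive_cst a t 1))).
by rewrite mulmx0 addr0 mulmxA.
Qed.

Lemma continuous_expmx_mul n (L : 'M[R]_n) (a : 'cV[R]_n) :
  continuous (fun t : R => expmx (t *: L) *m a).
Proof.
move=> t; apply/differentiable_continuous/derivable1_diffP.
by case: (is_derive_expmx_mul L a t).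
Qed.

Lemma continuous_quadf_expmx n (M L : 'M[R]_n) (a : 'cV[R]_n) :
  continuous (fun t : R => quadf M (expmx (t *: L) *m a)).
Proof.
apply: continuous_quadf => i t.
apply: (@continuous_comp _ _ _ (fun t : R => expmx (t *: L) *m a)
  (fun N : 'cV[R]_n => N i 0)); first exact: continuous_expmx_mul.
exact: coord_continuous.
Qed.

(* Passivity makes |z|^2 nonincreasing, which avoids inverting the exponential. *)
Lemma dissipative_ode_eq0 n (A : 'M[R]_n) (z : R -> 'cV[R]_n) :
  (forall x, quadf A x <= 0) -> z 0 = 0 ->
  {within `[0, +oo[, continuous z} ->
  (forall t : R, 0 < t -> is_derive t 1 z (A *m z t)) ->
  forall t, 0 <= t -> z t = 0.
Proof.
move=> A0 z0 cz dz t t0; apply: quadf1_eq0; apply/eqP.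
rewrite eq_le quadf1_ge0 andbT -(quadfv0 (1%:M : 'M[R]_n)) -z0.
pose f s := quadf 1%:M (z s).
have dfE (s : R) : 0 < s ->
    is_derive s 1 f (quadf (A^T *m 1%:M + 1%:M *m A) (z s)).
  by move=> s0; apply: is_derive_quadf; exact: dz.
have df s : s \in `]0, t[%R -> derivable f s 1.
  by rewrite in_itv /= => /andP[/dfE[]].
have dn s : s \in `]0, t[%R -> f^`() s <= 0.
  rewrite in_itv /= => /andP[/dfE[_ fE] _].
  by rewrite derive1E fE mulmx1 mul1mx quadfD quadf_tr -mulr2n mulrn_wle0.
have cf0 : {within `[0, +oo[, continuous f}.
  apply: continuous_quadf => i s.
  apply: (@continuous_comp _ _ _ (z : subspace `[0, +oo[ -> _)
    (fun N : 'cV[R]_n => N i 0)); first exact: cz.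
  exact: coord_continuous.
have sub : `[0, t] `<=` `[0, +oo[.
  by move=> s; rewrite /= !in_itv /= => /andP[->].
have cf := continuous_subspaceW sub cf0.
by apply: (ler0_derive1_le_cc df dn cf); rewrite // in_itv /= ?lexx ?t0.
Qed.

(** The control cancels in the difference of two trajectories, which then solves [z' = A z] from
    0. *)
Lemma trajectory_unique n q (A : 'M[R]_n) (B : 'M[R]_(n, q)) u x0 x y :
  (forall a, quadf A a <= 0) ->
  is_trajectory A B u x0 x -> is_trajectory A B u x0 y ->
  forall t, 0 <= t -> x t = y t.
Proof.
move=> A0 [x_0 cRx cIx dx] [y_0 cRy cIy dy] t t0.
(* [P] stands for the real or the imaginary part; both are additive and commute with real
   matrices. *)
have part (P : 'M[R[i]]_(n, 1) -> 'cV[R]_n) :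
    (forall a b, P (a + b) = P a + P b) ->
    (forall a, P (toC A *m a) = A *m P a) ->
    {within `[0, +oo[, continuous (fun s => P (x s))} ->
    {within `[0, +oo[, continuous (fun s => P (y s))} ->
    (forall s : R, 0 < s -> is_derive s 1 (fun r => P (x r))
       (P (toC A *m x s + toC B *m u s))) ->
    (forall s : R, 0 < s -> is_derive s 1 (fun r => P (y r))
       (P (toC A *m y s + toC B *m u s))) ->
    P (x t) = P (y t).
  move=> PD PA cx cy dPx dPy; apply/eqP; rewrite -subr_eq0; apply/eqP.
  apply: (@dissipative_ode_eq0 _ A (fun s => P (x s) - P (y s))) => //.
  - by rewrite x_0 y_0 subrr.
  - by move=> s; apply: cvgB; [exact: cx|exact: cy].
  - move=> s s0; apply: (@is_derive_eq _ _ _ _ _ _ _ _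
      (is_deriveB (dPx s s0) (dPy s s0))).
    by rewrite !PD !PA mulmxBr opprD addrACA subrr addr0.
apply: complex_mxP.
- apply: (part (map_mx (@complex.Re R))) => //.
  + exact: ReD.
  + exact: Re_toC.
  + by move=> s /dx[].
  + by move=> s /dy[].
- apply: (part (map_mx (@complex.Im R))) => //.
  + exact: ImD.
  + exact: Im_toC.
  + by move=> s /dx[].
  + by move=> s /dy[].
Qed.

Lemma feedback_trajectory n q (A : 'M[R]_n) (B : 'M[R]_(n, q)) (K : 'M[R]_(q, n))
    (x0 : 'cV[R[i]]_n) :
  let x := fun t : R => toC (expmx (t *: (A - B *m K))) *m x0 in
  is_trajectory A B (fun t => - (toC K *m x t)) x0 x.
Proof.
move=> x; set L := A - B *m K.
have xRe : (fun t => Re (x t)) = (fun t => expmx (t *: L) *m Re x0).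
  by apply/funext => t; rewrite Re_toC.
have xIm : (fun t => Im (x t)) = (fun t => expmx (t *: L) *m Im x0).
  by apply/funext => t; rewrite Im_toC.
split=> [|||t _].
- by rewrite /x expmx0 /toC map_mx1 mul1mx.
- by rewrite xRe; apply: continuous_subspaceT; exact: continuous_expmx_mul.
- by rewrite xIm; apply: continuous_subspaceT; exact: continuous_expmx_mul.
- rewrite xRe xIm; split.
    apply: (@is_derive_eq _ _ _ _ _ _ _ _ (is_derive_expmx_mul _ _ _)).
    by rewrite ReD !Re_toC ReN !Re_toC /L mulmxBl mulmxN -!mulmxA.
  apply: (@is_derive_eq _ _ _ _ _ _ _ _ (is_derive_expmx_mul _ _ _)).
  by rewrite ImD !Im_toC ImN !Im_toC /L mulmxBl mulmxN -!mulmxA.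
Qed.

(** [trajectory] picks some solution; the exponential shows that one exists, and uniqueness
    identifies the two on the domain of integration. *)
Lemma cost_feedback n q p (A : 'M[R]_n) (B : 'M[R]_(n, q)) (C : 'M[R]_(p, n))
    (K : 'M[R]_(q, n)) (x0 : 'cV[R[i]]_n) :
  (forall a, quadf A a <= 0) ->
  let E := fun t : R => expmx (t *: (A - B *m K)) in
  let Q := C^T *m C + K^T *m K in
  cost A B C (fun t => - (toC K *m (toC (E t) *m x0))) x0 =
  (\int[mu]_(t in `[0%R, +oo[)
     (quadf Q (E t *m Re x0) + quadf Q (E t *m Im x0))%:E)%E.
Proof.
move=> A0 E Q; rewrite /cost; set u := fun t => - _.
have trE := feedback_trajectory A B K x0.
have trx : is_trajectory A B u x0 (trajectory A B u x0).
  by rewrite /trajectory; apply: xgetPex; eexists; exact: trE.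
apply: eq_integral => t; rewrite inE /= in_itv /= andbT => t0; congr EFin.
rewrite (trajectory_unique A0 trx trE t0) mxE raddfD /= Re_hermitian Re_dotc.
rewrite /u ReN ImN !Re_toC !Im_toC -/(E t).
have nrm (a : 'cV[R]_n) : ((- (K *m a))^T *m (- (K *m a))) 0 0 = quadf (K^T *m K) a.
  rewrite -[X in (X *m _) 0 0]mulmx1 -/(quadf 1%:M _) quadfNv.
  by rewrite quadf1_mul.
by rewrite !nrm !quadfD; ring.
Qed.

End linear_feedback.

(** * The closed-loop Riccati identity and the decay of the reduced system *)

Section lyapunov.
Variable R : realType.
Implicit Types (n q p : nat).

(** Closing the loop subtracts [X B B^T X] twice, and [K^T K] adds it back once. *)
Lemma riccati_feedback n q p (A : 'M[R]_n) (B : 'M[R]_(n, q)) (C : 'M[R]_(p, n))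
    (X : 'M[R]_n) : X^T = X ->
  let K := B^T *m X in
  let L := A - B *m K in
  L^T *m X + X *m L + (C^T *m C + K^T *m K) = riccati A B C X.
Proof.
move=> XT K L; have KT : K^T = X *m B by rewrite trmx_mul trmxK XT.
rewrite /L linearB /= trmx_mul KT mulmxBl mulmxBr /riccati /K !mulmxA.
set a := A^T *m X; set b := X *m A; set c := X *m B *m B^T *m X; set e := C^T *m C.
by clearbody a b c e; apply/matrixP => i j; rewrite !mxE; ring.
Qed.

(* With K = B^T Y, the derivative of |x|^2 is at most
   - b |x|^2 + k |K x|^2 by coercivity of T and Young's inequality, and the
   derivative of x^T Y x is - |C x|^2 - |K x|^2; hence |x|^2 + k x^T Y x decays
   exponentially. *)
Lemma riccati_decay n q p (T : 'M[R]_n) (B : 'M[R]_(n, q)) (C : 'M[R]_(p, n))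
    (Y : 'M[R]_n) (a : 'cV[R]_n) :
  (forall x, x != 0 -> quadf T x < 0) -> psd Y -> riccati T B C Y = 0 ->
  quadf Y (expmx (t *: (T - B *m (B^T *m Y))) *m a) @[t --> +oo] --> 0.
Proof.
move=> Tneg [YT Y0] ric; set K := B^T *m Y; set L := T - B *m K.
have [b b0 Tb] := neg_quadf_coercive Tneg.
have [c c0 Bc] := quadf_bound (B *m B^T).
have [d d0 Yd] := quadf_bound Y.
(* With this weight, the decrease of [k x^T Y x] absorbs the [|K x|^2] term left by Young's
   inequality at parameter [b / c]. *)
pose k := c / b.
have k0 : 0 < k by rewrite divr_gt0.
pose P := 1%:M + k *: Y.
(* The net decrease is at least [b |x|^2] while [P] is at most [(1 + k d) |x|^2]; the rate is the
   quotient. *)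
pose g := b / (1 + k * d).
have kd0 : 0 < 1 + k * d by apply: addr_gt0 => //; exact: mulr_gt0.
have g0 : 0 < g by rewrite divr_gt0.
pose x t := expmx (t *: L) *m a.
have dP (t : R) : is_derive t 1 (fun s => quadf P (x s))
    (quadf (L^T *m P + P *m L) (x t)).
  by apply: is_derive_quadf; exact: is_derive_expmx_mul.
have LY : L^T *m Y + Y *m L = - (C^T *m C + K^T *m K).
  by apply/eqP; rewrite -subr_eq0 opprK riccati_feedback // ric.
have dec z : quadf (L^T *m P + P *m L) z <= - g * quadf P z.
  have -> : L^T *m P + P *m L = (L^T + L) + k *: (L^T *m Y + Y *m L).
    rewrite /P mulmxDr mulmxDl mulmx1 mul1mx -scalemxAr -scalemxAl scalerDr.
    by rewrite addrACA.
  have BKz : quadf (B *m K) z = ((B^T *m z)^T *m (K *m z)) 0 0.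
    by rewrite /quadf trmx_mul trmxK !mulmxA.
  (* The parameter [b / c] turns [|B^T z|^2 <= c |z|^2] into [b |z|^2], half of the [2 b |z|^2] that
     [T] supplies. *)
  have yo := young (B^T *m z) (- (K *m z)) (divr_gt0 b0 c0).
  have CC : 0 <= k * quadf (C^T *m C) z.
    by rewrite mulr_ge0 ?(ltW k0) // -quadf1_mul quadf1_ge0.
  have Bz : b / c * quadf (B *m B^T) z <= b * quadf 1%:M z.
    rewrite -mulrA ler_pM2l // mulrC ler_pdivrMr // mulrC.
    exact: le_trans (ler_norm _) (Bc z).
  have gP : g * (quadf 1%:M z + k * quadf Y z) <= b * quadf 1%:M z.
    rewrite /g mulrAC ler_pdivrMr // -[leRHS]mulrA ler_pM2l //.
    rewrite mulrDr mulr1 lerD2l [leRHS]mulrC -[leRHS]mulrA ler_pM2l //.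
    exact: le_trans (ler_norm _) (Yd z).
  have Tz := Tb z.
  move: yo; rewrite mulmxN mxE -BKz quadfNv !quadf1_mul trmxK invf_div -/k => yo.
  have Lz : quadf L z = quadf T z - quadf (B *m K) z by rewrite quadfD quadfN.
  rewrite /P LY quadfD quadfZ [quadf (L^T + L) z]quadfD quadf_tr Lz quadfN.
  rewrite !quadfD quadfZ mulrN mulrDr mulNr.
  move: Tz; rewrite mulNr => Tz; lra.
have Px t : quadf P (x t) = quadf 1%:M (x t) + k * quadf Y (x t).
  by rewrite quadfD quadfZ.
have Yx t : 0 <= quadf Y (x t) by exact: Y0.
have bnd t : 0 <= t -> quadf Y (x t) <= quadf P (x 0) / k * expR (- g * t).
  move=> t0; rewrite mulrAC ler_pdivlMr // [leRHS]mulrC.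
  apply: le_trans (exp_decay dP (fun t => dec (x t)) t0).
  by rewrite Px mulrC lerDr quadf1_ge0.
apply: (exp_bounded_cvg0 (c := quadf P (x 0) / k) g0) => t t0.
by rewrite (ger0_norm (Yx t)); exact: bnd.
Qed.

End lyapunov.

(** * The cost of a feedback up to its Riccati residual *)

Section feedback_cost.
Variable R : realType.
Local Notation Re := (map_mx (@complex.Re R)).
Local Notation Im := (map_mx (@complex.Im R)).

(** Serves both systems: [c] and [k] measure the residual along the trajectory, and the decay of
    [x^* X x] is a separate hypothesis because it is obtained differently in each case. *)
Lemma feedback_cost_bound n q p (A : 'M[R]_n) (B : 'M[R]_(n, q))
    (C : 'M[R]_(p, n)) (X : 'M[R]_n) (x0 : 'cV[R[i]]_n) (c k : R) :
  (forall a, quadf A a <= 0) -> X^T = X -> 0 <= c -> 0 < k ->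
  let E := fun t : R => expmx (t *: (A - B *m (B^T *m X))) in
  (forall a : 'cV[R]_n, quadf X (E t *m a) @[t --> +oo] --> 0) ->
  (forall t, 0 <= t ->
    `|quadf (riccati A B C X) (E t *m Re x0) +
      quadf (riccati A B C X) (E t *m Im x0)| <= c * expR (- k * t)) ->
  (`| cost A B C (fun t => (- (toC (B^T *m X) *m (toC (E t) *m x0)))%R) x0
      - (quadf X (Re x0) + quadf X (Im x0))%:E | <= (c / k)%:E)%E.
Proof.
move=> A0 XT c0 k0 E X0 bnd; set K := B^T *m X; set L := A - B *m K.
rewrite (cost_feedback B C K x0 A0); set Q := C^T *m C + K^T *m K.
have Q0 a : 0 <= quadf Q a by rewrite quadfD -!quadf1_mul addr_ge0 ?quadf1_ge0.
pose S a b (t : R) := quadf X (E t *m a) + quadf X (E t *m b).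
have -> : quadf X (Re x0) + quadf X (Im x0) = S (Re x0) (Im x0) 0.
  by rewrite /S /E expmx0 !mul1mx.
(* [W] gives the derivative of the [X]-form along the flow, and [W + Q] is the Riccati residual. *)
pose W := L^T *m X + X *m L.
apply: (@lyapunov_integral _ _ _
  (fun t => quadf W (E t *m Re x0) + quadf W (E t *m Im x0))) => //.
- by move=> t; rewrite addr_ge0.
- by move=> t; apply: cvgD; exact: continuous_quadf_expmx.
- by move=> t; apply: is_deriveD; apply: is_derive_quadf; exact: is_derive_expmx_mul.
- by move=> t; apply: cvgD; exact: continuous_quadf_expmx.
- by rewrite -(addr0 0); apply: cvgD; exact: X0.
- move=> t /bnd; rewrite -riccati_feedback // -/K -/L -/W -/Q.
  by rewrite !(quadfD W Q) addrACA addrC.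
Qed.

End feedback_cost.

(** * Comparison of the full and reduced costs *)

Theorem proposition3p3 (R : realType) (n q p d : nat)
    (A : 'M[R]_n) (B : 'M[R]_(n, q)) (C : 'M[R]_(p, n)) (x0 : 'cV[R[i]]_n)
    (V : 'M[R]_(n, d)) (Y : 'M[R]_d) (alpha : R) :
  let T := V^T *m A *m V in
  let Bk := V^T *m B in
  let Ck := C *m V in
  let xhat0 := (toC V) ^t* *m x0 in
  let X := V *m Y *m V^T in
  let Rk := riccati A B C X in
  let Acl := A - B *m B^T *m X in
  let xk := fun t : R => toC (expmx (t *: Acl)) *m x0 in
  let uk := fun t : R => - (toC (B^T *m X) *m xk t) in
  let uhat := fun t : R =>
    - (toC (Bk^T *m Y *m expmx (t *: (T - Bk *m Bk^T *m Y))) *m xhat0) in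
  passive A ->
  V^T *m V = 1%:M ->
  psd Y -> riccati T Bk Ck Y = 0 -> stable (T - Bk *m Bk^T *m Y) ->
  stable Acl ->
  0 < alpha ->
  (forall t : R, 0 <= t -> opnorm (toC (expmx (t *: Acl^T))) <= expR (- alpha * t)) ->
  (`| cost A B C uk x0 - cost T Bk Ck uhat xhat0 |
    <= (opnorm (toC Rk) / (2 * alpha) * complex.Re ((x0 ^t* *m x0) 0 0))%:E)%E.
Proof.
move=> T Bk Ck xhat0 X Rk Acl xk uk uhat pA VV psdY ric _ _ alpha0 Edecay.
have [YT Y0] := psdY.
have A0 a : quadf A a <= 0.
  by have [->|/(passive_quadf pA)/ltW//] := eqVneq a 0; rewrite quadfv0.
(* [V^T V = 1] makes [V] injective, so the compression [T] inherits negativity from [A]. *)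
have Tneg a : a != 0 -> quadf T a < 0.
  move=> a0; rewrite -quadf_mul; apply: passive_quadf pA _.
  by apply: contra_neq a0 => Va0; rewrite -[a]mul1mx -VV -mulmxA Va0 mulmx0.
have T0 a : quadf T a <= 0.
  by have [->|/Tneg/ltW//] := eqVneq a 0; rewrite quadfv0.
have XT : X^T = X by rewrite /X !trmx_mul trmxK YT mulmxA.
have xhat0E : xhat0 = toC V^T *m x0.
  rewrite /xhat0; congr (_ *m _); apply/matrixP => i j; rewrite !mxE.
  by apply/eqP; rewrite eq_complex /= oppr0 !eqxx.
have AclE : Acl = A - B *m (B^T *m X) by rewrite mulmxA.
pose nx := quadf 1%:M (map_mx (@complex.Re R) x0) +
  quadf 1%:M (map_mx (@complex.Im R) x0).
have nxE : complex.Re ((x0 ^t* *m x0) 0 0) = nx.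
  by rewrite Re_dotc /nx /quadf !mulmx1.
(* Squaring the norm doubles the rate, whence the [2 * alpha] of the final bound. *)
have decay a t : 0 <= t -> quadf 1%:M (expmx (t *: Acl) *m a) <=
    expR (- (2 * alpha) * t) * quadf 1%:M a.
  move=> t0; have := Edecay t t0; rewrite expmx_tr.
  move=> /(quadf1_opnorm_tr a (expR_ge0 _)) /le_trans; apply.
  rewrite (_ : expR (- (2 * alpha) * t) = expR (- alpha * t) ^+ 2) //.
  by rewrite -expRM_natl; congr expR; ring.
have a20 : 0 < 2 * alpha by rewrite mulr_gt0.
have Rbnd M t : 0 <= t ->
    `|quadf M (expmx (t *: Acl) *m map_mx (@complex.Re R) x0) +
      quadf M (expmx (t *: Acl) *m map_mx (@complex.Im R) x0)| <=
    opnorm (toC M) * nx * expR (- (2 * alpha) * t).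
  move=> t0; apply: le_trans (ler_normD _ _) _.
  apply: le_trans (lerD (quadf_opnorm _ _) (quadf_opnorm _ _)) _.
  rewrite -mulrDr -mulrA ler_wpM2l ?opnorm_ge0 // mulrC mulrDr.
  by rewrite lerD ?decay.
have full : (`|cost A B C uk x0 - (quadf X (map_mx (@complex.Re R) x0) +
    quadf X (map_mx (@complex.Im R) x0))%:E| <=
    (opnorm (toC Rk) * nx / (2 * alpha))%:E)%E.
  have := @feedback_cost_bound R n q p A B C X x0 (opnorm (toC Rk) * nx) (2 * alpha).
  rewrite -AclE; apply => //.
  - by rewrite mulr_ge0 ?opnorm_ge0 // addr_ge0 ?quadf1_ge0.
  - move=> a; have [c c0 Xc] := quadf_bound X.
    apply: (exp_bounded_cvg0 (c := c * quadf 1%:M a) a20) => t t0.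
    apply: le_trans (Xc _) _; rewrite -mulrA ler_pM2l // mulrC; exact: decay.
  - by move=> t; exact: Rbnd.
(* The residual vanishes, so [c = 0] and [k = 1] are admissible, and the reduced cost is exactly the
   common value. *)
have reduced : (`|cost T Bk Ck uhat xhat0 - (quadf X (map_mx (@complex.Re R) x0) +
    quadf X (map_mx (@complex.Im R) x0))%:E| <= (0 / 1)%:E)%E.
  have -> : uhat = fun t => - (toC (Bk^T *m Y) *m
      (toC (expmx (t *: (T - Bk *m (Bk^T *m Y)))) *m xhat0)).
    by apply/funext => t; rewrite /uhat /toC map_mxM -!mulmxA.
  have := @feedback_cost_bound R d q p T Bk Ck Y xhat0 0 1.
  (* Moving [V^T] from the initial vector into the form turns [Y] into [V Y V^T], which is [X]. *)
  rewrite [in map_mx (@complex.Re R) xhat0]xhat0E.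
  rewrite [in map_mx (@complex.Im R) xhat0]xhat0E Re_toC Im_toC !quadf_mul !trmxK.
  apply => //.
  - by move=> a; exact: (riccati_decay _ Tneg psdY ric).
  - by move=> t _; rewrite ric !quadf0 addr0 normr0 mul0r.
rewrite nxE.
(* An infinite cost would contradict its finite bound, so both costs are real. *)
move: full reduced; case: (cost A B C _ _) => [r| |] //;
  case: (cost T _ _ _ _) => [s| |] //.
rewrite /= !lee_fin mul0r => h1 h2.
rewrite mulrAC; move: h1 h2; rewrite !ler_norml; lra.
Qed.
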